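(* Let $\mathbf H$ be a connected Hopf monoid in vector species over $\Bbbk$ with antipode $\mathsf s$, let $\zeta$ be a character of $\mathbf H$, and let $\chi$ be the polynomial invariant associated to $\zeta$. For every finite set $I$ and $x\in\mathbf H[I]$, $$\chi_I(x)(-1)=\zeta_I\big(\mathsf s_I(x)\big).$$ More generally, for every scalar $n$, $$\chi_I(x)(-n)=\chi_I\big(\mathsf s_I(x)\big)(n).$$
   Context: $\Bbbk$ is a field of characteristic $0$. A vector species is a functor from finite sets with bijections to $\Bbbk$-vector spaces. A connected Hopf monoid in vector species is a vector species $\mathbf H$ with $\mathbf H[\emptyset]=\Bbbk$ together with linear maps $\mu_{S,T}:\mathbf H[S]\otimes\mathbf H[T]\to\mathbf H[I]$ and $\Delta_{S,T}:\mathbf H[I]\to\mathbf H[S]\otimes\mathbf H[T]$ for each ordered decomposition $I=S\sqcup T$ (parts may be empty), such that: both are natural with respect to bijections; (unitality) $\mu_{I,\emptyset},\mu_{\emptyset,I},\Delta_{I,\emptyset},\Delta_{\emptyset,I}$ are the canonical identifications; (associativity) for $I=R\sqcup S\sqcup T$, $\mu_{R,S\sqcup T}(\mathrm{id}\otimes\mu_{S,T})=\mu_{R\sqcup S,T}(\mu_{R,S}\otimes\mathrm{id})$ and $(\mathrm{id}\otimes\Delta_{S,T})\Delta_{R,S\sqcup T}=(\Delta_{R,S}\otimes\mathrm{id})\Delta_{R\sqcup S,T}$; (compatibility) for $S\sqcup T=I=S'\sqcup T'$ with $A=S\cap S'$, $B=S\cap T'$, $C=T\cap S'$, $D=T\cap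 T'$, $\Delta_{S',T'}\circ\mu_{S,T}=(\mu_{A,C}\otimes\mu_{B,D})\circ(\mathrm{id}\otimes\mathrm{swap}\otimes\mathrm{id})\circ(\Delta_{A,B}\otimes\Delta_{C,D})$. $\mu_{S_1,\dots,S_k}$ and $\Delta_{S_1,\dots,S_k}$ denote the iterated product and coproduct (identities for $k=1$; for $k=0$ and $I=\emptyset$ the identity of $\Bbbk$). The antipode is $\mathsf s_\emptyset=\mathrm{id}$ and, for $I\neq\emptyset$, $\mathsf s_I=\sum(-1)^k\mu_{S_1,\dots,S_k}\circ\Delta_{S_1,\dots,S_k}$, over all $k\ge1$ and ordered sequences $(S_1,\dots,S_k)$ of nonempty pairwise disjoint sets with union $I$. A character $\zeta$ of $\mathbf H$ is a family of linear maps $\zeta_I:\mathbf H[I]\to\Bbbk$ which is natural ($\zeta_J(\mathbf H[\sigma](x))=\zeta_I(x)$ for bijections $\sigma:I\to J$), multiplicative ($\zeta_I(\mu_{S,T}(x\otimes y))=\zeta_S(x)\zeta_T(y)$) and unital ($\zeta_\emptyset(1)=1$). The polynomial invariant $\chi$ associated to $\zeta$: for $x\in\mathbf H[I]$, $\chi_I(x)\in\Bbbk[t]$ is the unique polynomial whose value at each $n\in\mathbb N$ is $\chi_I(x)(n)=\sum_{I=S_1\sqcup\cdots\sqcup S_n}(\zeta_{S_1}\otimes\cdots\otimes\zeta_{S_n})\circ\Delta_{S_1,\dots,S_n}(x)$, the sum over all ordered decompositions of $I$ into $n$ pairwise disjoint, possibly empty, subsets (these values are given by a polynomial in $n$ of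 degree at most $|I|$). *)

(* Defs.v *)
From HB Require Import structures.
From mathcomp Require Import all_boot all_order all_algebra generic_quotient.
From mathcomp Require Import sesquilinear boolp.
From mathcomp Require classical_sets.

Set Implicit Arguments.
Unset Strict Implicit.
Unset Printing Implicit Defensive.

Import GRing.Theory.
Local Open Scope ring_scope.
Local Open Scope quotient_scope.

(* [tensor U V] consists of the formal sums of pairs (u, v), two formal sums  *)
(* being identified when every bilinear map takes the same value on them. The *)
(* universal property is [tliftE] and [tensor_linear_ext].                    *)
Section Tensor.
Variables (k : fieldType) (U V : lmodType k).

Definition tsum (W : lmodType k) (f : {bilinear U -> V -> W})
  (s : seq (U * V)) : W := \sum_(p <- s) f p.1 p.2.

Definition tensor_eq (s t : seq (U * V)) : bool :=
  `[< forall (W : lmodType k) (f : {bilinear U -> V -> W}),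
      tsum f s = tsum f t >].

Lemma tensor_eqP s t :
  reflect (forall (W : lmodType k) (f : {bilinear U -> V -> W}),
             tsum f s = tsum f t) (tensor_eq s t).
Proof. exact: asboolP. Qed.

Lemma tensor_eq_is_equiv : equiv_class_of tensor_eq.
Proof.
split=> [s|s t|t s r].
- exact/tensor_eqP.
- by apply/tensor_eqP/tensor_eqP => h W f; rewrite h.
- by move=> /tensor_eqP h1 /tensor_eqP h2; apply/tensor_eqP => W f; rewrite h1.
Qed.

Canonical tensor_equiv := EquivRelPack tensor_eq_is_equiv.

Definition tensor := {eq_quot tensor_equiv}.

HB.instance Definition _ := Choice.on tensor.
HB.instance Definition _ := EqQuotient.on tensor.

Lemma tensorP s t :
  (forall (W : lmodType k) (f : {bilinear U -> V -> W}), tsum f s = tsum f t) ->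
  \pi_tensor s = \pi_tensor t.
Proof. by move=> h; apply/eqmodP/tensor_eqP. Qed.

Lemma tsum_repr (W : lmodType k) (f : {bilinear U -> V -> W}) s :
  tsum f (repr (\pi_tensor s)) = tsum f s.
Proof.
have /eqmodP/tensor_eqP : \pi_tensor (repr (\pi_tensor s)) = \pi_tensor s.
  by rewrite reprK.
exact.
Qed.

Lemma tsum_cat (W : lmodType k) (f : {bilinear U -> V -> W}) s t :
  tsum f (s ++ t) = tsum f s + tsum f t.
Proof. by rewrite /tsum big_cat. Qed.

Definition seq_scale (a : k) (s : seq (U * V)) := [seq (a *: p.1, p.2) | p <- s].

Lemma tsum_scale (W : lmodType k) (f : {bilinear U -> V -> W}) a s :
  tsum f (seq_scale a s) = a *: tsum f s.
Proof.
rewrite /tsum big_map scaler_sumr; apply: eq_bigr => p _ /=.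
exact: linearZl_LR.
Qed.

Definition tensor_zero : tensor := \pi_tensor [::].
Definition tensor_add (x y : tensor) : tensor := \pi_tensor (repr x ++ repr y).
Definition tensor_scale (a : k) (x : tensor) : tensor :=
  \pi_tensor (seq_scale a (repr x)).
Definition tensor_opp (x : tensor) : tensor := tensor_scale (-1) x.

Lemma tsum_nil (W : lmodType k) (f : {bilinear U -> V -> W}) : tsum f [::] = 0.
Proof. exact: big_nil. Qed.

Definition tsumE := (tsum_repr, tsum_cat, tsum_scale, tsum_nil).

Lemma tensor_ext (x y : tensor) :
  (forall (W : lmodType k) (f : {bilinear U -> V -> W}),
     tsum f (repr x) = tsum f (repr y)) -> x = y.
Proof. by move=> h; rewrite -[x]reprK -[y]reprK; apply: tensorP. Qed.

Lemma tensor_addA : associative tensor_add.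
Proof. by move=> x y z; apply: tensor_ext => W f; rewrite !tsumE addrA. Qed.
Lemma tensor_addC : commutative tensor_add.
Proof. by move=> x y; apply: tensor_ext => W f; rewrite !tsumE addrC. Qed.
Lemma tensor_add0 : left_id tensor_zero tensor_add.
Proof.
by move=> x; apply: tensor_ext => W f; rewrite !tsumE add0r.
Qed.
Lemma tensor_addN : left_inverse tensor_zero tensor_opp tensor_add.
Proof.
move=> x; apply: tensor_ext => W f.
by rewrite !tsumE scaleN1r addNr.
Qed.

HB.instance Definition _ :=
  GRing.isZmodule.Build tensor tensor_addA tensor_addC tensor_add0 tensor_addN.

Lemma tensor_scaleA a b (x : tensor) :
  tensor_scale a (tensor_scale b x) = tensor_scale (a * b) x.
Proof. by apply: tensor_ext => W f; rewrite !tsumE scalerA. Qed.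
Lemma tensor_scale1 : left_id 1 tensor_scale.
Proof. by move=> x; apply: tensor_ext => W f; rewrite !tsumE scale1r. Qed.
Lemma tensor_scaleDr : right_distributive tensor_scale +%R.
Proof. by move=> a x y; apply: tensor_ext => W f; rewrite !tsumE scalerDr. Qed.
Lemma tensor_scaleDl (x : tensor) : {morph tensor_scale^~ x : a b / a + b}.
Proof. by move=> a b; apply: tensor_ext => W f; rewrite !tsumE scalerDl. Qed.

HB.instance Definition _ := GRing.Zmodule_isLmodule.Build k tensor
  tensor_scaleA tensor_scale1 tensor_scaleDr tensor_scaleDl.

Definition tens : lmodType k := GRing.Lmodule.clone k tensor _.

Definition tpure (u : U) (v : V) : tens := \pi_tensor [:: (u, v)].

Lemma tsum1 (W : lmodType k) (f : {bilinear U -> V -> W}) u v :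
  tsum f [:: (u, v)] = f u v.
Proof. by rewrite /tsum big_seq1. Qed.

Lemma tpure_is_bilinear : bilinear_for *:%R *:%R tpure.
Proof.
split=> [v a u u'|u a v v']; apply: tensor_ext => W f.
- by rewrite !tsumE !tsum1 linearPl.
- by rewrite !tsumE !tsum1 linearPr.
Qed.
HB.instance Definition _ :=
  bilinear_isBilinear.Build k U V tens *:%R *:%R tpure tpure_is_bilinear.

Definition tlift (W : lmodType k) (f : {bilinear U -> V -> W}) (x : tens) : W :=
  tsum f (repr x).

Lemma tlift_is_linear (W : lmodType k) (f : {bilinear U -> V -> W}) :
  linear (tlift f).
Proof. by move=> a x y; rewrite /tlift !tsumE. Qed.
HB.instance Definition _ (W : lmodType k) (f : {bilinear U -> V -> W}) :=
  GRing.isLinear.Build k tens W *:%R (@tlift W f) (@tlift_is_linear W f).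

Lemma tliftE (W : lmodType k) (f : {bilinear U -> V -> W}) u v :
  tlift f (tpure u v) = f u v.
Proof. by rewrite /tlift tsumE tsum1. Qed.

Lemma tensor_sum (x : tens) : x = \sum_(p <- repr x) tpure p.1 p.2.
Proof.
rewrite -{1}[x]reprK; elim: (repr x) => [|p s ih]; first by rewrite big_nil.
rewrite big_cons -ih; apply: tensor_ext => W f.
by rewrite !tsumE /tsum big_cons big_seq1.
Qed.

Lemma tensor_linear_ext (W : lmodType k) (f g : {linear tens -> W}) :
  (forall u v, f (tpure u v) = g (tpure u v)) -> f =1 g.
Proof.
by move=> h x; rewrite [x]tensor_sum !linear_sum; apply: eq_bigr => p _.
Qed.

End Tensor.

Arguments tens {k} U V.
Arguments tpure {k U V} u v.

Notation "U ⊗ V" := (tens U V) (at level 40, left associativity) : type_scope.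

Section TensorMaps.
Variable k : fieldType.

Section Map.
Variables (U V U' V' : lmodType k).
Variables (f : {linear U -> U'}) (g : {linear V -> V'}).

Definition tmap_fun (u : U) (v : V) : U' ⊗ V' := tpure (f u) (g v).
Lemma tmap_fun_bilinear : bilinear_for *:%R *:%R tmap_fun.
Proof.
by split=> [v a u u'|u a v v']; rewrite /tmap_fun linearP ?linearPl ?linearPr.
Qed.
HB.instance Definition _ :=
  bilinear_isBilinear.Build k U V (U' ⊗ V') *:%R *:%R tmap_fun tmap_fun_bilinear.

Definition tmap : {linear U ⊗ V -> U' ⊗ V'} := tlift tmap_fun.

Lemma tmapE u v : tmap (tpure u v) = tpure (f u) (g v).
Proof. exact: tliftE. Qed.
End Map.

Section Assoc.
Variables (U V W : lmodType k).

Definition tassoc_fun (p : U ⊗ V) (w : W) : U ⊗ (V ⊗ W) :=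
  tmap (idfun : {linear U -> U}) (applyr (@tpure k V W) w) p.
Lemma tassoc_fun_bilinear : bilinear_for *:%R *:%R tassoc_fun.
Proof.
split=> [w a p p'|p a w w']; rewrite /tassoc_fun; first exact: linearP.
rewrite [p]tensor_sum !linear_sum /= scaler_sumr -big_split /=.
by apply: eq_bigr => q _; rewrite !tmapE /= linearPr linearPr.
Qed.
HB.instance Definition _ := bilinear_isBilinear.Build k (U ⊗ V) W (U ⊗ (V ⊗ W))
  *:%R *:%R tassoc_fun tassoc_fun_bilinear.

Definition tassoc : {linear (U ⊗ V) ⊗ W -> U ⊗ (V ⊗ W)} := tlift tassoc_fun.

Lemma tassocE u v w : tassoc (tpure (tpure u v) w) = tpure u (tpure v w).
Proof. by rewrite /tassoc /= tliftE /= /tassoc_fun tmapE. Qed.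
End Assoc.

Section MidSwap.
Variables (U V U' V' : lmodType k).

Section Inner.
Variable q : U' ⊗ V'.
Definition tmid_inner (u : U) (v : V) : (U ⊗ U') ⊗ (V ⊗ V') :=
  tmap ((@tpure k U U' : {bilinear U -> U' -> U ⊗ U'}) u)
       ((@tpure k V V' : {bilinear V -> V' -> V ⊗ V'}) v) q.
Lemma tmid_inner_bilinear : bilinear_for *:%R *:%R tmid_inner.
Proof.
split=> [v a u u'|u a v v']; rewrite /tmid_inner [q]tensor_sum !linear_sum /=
  scaler_sumr -big_split /=; apply: eq_bigr => p _.
- by rewrite !tliftE /= /tmap_fun /= (tpure_is_bilinear _ _).1 linearPl.
- by rewrite !tliftE /= /tmap_fun /= (tpure_is_bilinear _ _).1 (tpure_is_bilinear _ _).2.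
Qed.
HB.instance Definition _ := bilinear_isBilinear.Build k U V
  ((U ⊗ U') ⊗ (V ⊗ V')) *:%R *:%R tmid_inner tmid_inner_bilinear.
End Inner.

Definition tmid_fun (p : U ⊗ V) (q : U' ⊗ V') : (U ⊗ U') ⊗ (V ⊗ V') :=
  tlift (tmid_inner q) p.
Lemma tmid_fun_bilinear : bilinear_for *:%R *:%R tmid_fun.
Proof.
split=> [q a p p'|p a q q']; rewrite /tmid_fun; first exact: linearP.
rewrite [p]tensor_sum !linear_sum /= scaler_sumr -big_split /=.
by apply: eq_bigr => r _; rewrite !tliftE /= /tmid_inner linearP.
Qed.
HB.instance Definition _ := bilinear_isBilinear.Build k (U ⊗ V) (U' ⊗ V')
  ((U ⊗ U') ⊗ (V ⊗ V')) *:%R *:%R tmid_fun tmid_fun_bilinear.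

Definition tmidswap :
  {linear (U ⊗ V) ⊗ (U' ⊗ V') -> (U ⊗ U') ⊗ (V ⊗ V')} := tlift tmid_fun.

Lemma tmidswapE u v u' v' :
  tmidswap (tpure (tpure u v) (tpure u' v')) = tpure (tpure u u') (tpure v v').
Proof. by rewrite /tmidswap /= tliftE /= /tmid_fun tliftE /= /tmid_inner tmapE. Qed.
End MidSwap.

(* f ⊗ g for scalar-valued f and g, followed by k ⊗ k = k *)
Section Scalar.
Variables (U V : lmodType k) (f : {linear U -> k^o}) (g : {linear V -> k^o}).

Definition tscal_fun (u : U) (v : V) : k^o := f u * g v.
Lemma tscal_fun_bilinear : bilinear_for *:%R *:%R tscal_fun.
Proof.
split=> [v a u u'|u a v v']; rewrite /tscal_fun linearP /=.
- by rewrite mulrDl -mulrA.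
- by rewrite mulrDr mulrCA.
Qed.
HB.instance Definition _ :=
  bilinear_isBilinear.Build k U V k^o *:%R *:%R tscal_fun tscal_fun_bilinear.

Definition tscal : {linear U ⊗ V -> k^o} := tlift tscal_fun.

Lemma tscalE u v : tscal (tpure u v) = f u * g v.
Proof. exact: tliftE. Qed.
End Scalar.

End TensorMaps.

Record species (k : fieldType) := Species {
  sp_obj :> finType -> lmodType k;
  sp_map : forall (X Y : finType) (f : X -> Y), bijective f ->
    {linear sp_obj X -> sp_obj Y};
  sp_map_id : forall (X : finType) (hid : bijective (fun x : X => x)),
    sp_map hid =1 id;
  sp_map_comp : forall (X Y Z : finType) (f : X -> Y) (g : Y -> Z)
    (hf : bijective f) (hg : bijective g) (hgf : bijective (fun x => g (f x))),
    sp_map hgf =1 sp_map hg \o sp_map hf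
}.

Definition finset_type (X : finType) (I : {set X}) : finType :=
  Finite.clone {x : X | x \in I} _.

(* Decomposed sets are subsets I of an ambient finite type X, and H⟦I⟧ is    *)
(* the value of H at the finite set I (an arbitrary finite type T is          *)
(* presented by [set: T]).                                                    *)
Notation "H ⟦ I ⟧" := (sp_obj H (finset_type I))
  (at level 2, I at level 200, left associativity, format "H ⟦ I ⟧") : type_scope.

Section Decompositions.
Variable X : finType.

Definition decomp (S T I : {set X}) : bool := [disjoint S & T] && (S :|: T == I).

Definition bigunion (s : seq {set X}) : {set X} := (\bigcup_(S <- s) S)%SET.

Definition is_decomposition (s : seq {set X}) (I : {set X}) : bool :=
  pairwise (fun S T : {set X} => [disjoint S & T]) s && (bigunion s == I).

Definition is_composition (s : seq {set X}) (I : {set X}) : bool :=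
  is_decomposition s I && all (fun S : {set X} => S != set0) s.

End Decompositions.

Definition restricts (X Y : finType) (S I : {set X}) (S' I' : {set Y})
  (f : finset_type S -> finset_type S') (h : finset_type I -> finset_type I') :=
  forall s i, val s = val i -> val (f s) = val (h i).

(* The maps [hm_mu S T I], [hm_delta S T I] (resp. [hm_unit E], [hm_counit E]) *)
(* are defined for all arguments, but are only meaningful, and only           *)
(* constrained, when I = S ⊔ T (resp. when E is empty). The identification    *)
(* H[∅] = k is the pair of mutually inverse maps [hm_unit], [hm_counit].      *)
Record hopf_monoid (k : fieldType) := HopfMonoid {
  hm_sp :> species k;
  hm_unit : forall E : finType, {linear k^o -> hm_sp E};
  hm_counit : forall E : finType, {linear hm_sp E -> k^o};
  hm_mu : forall (X : finType) (S T I : {set X}),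
    {linear hm_sp⟦S⟧ ⊗ hm_sp⟦T⟧ -> hm_sp⟦I⟧};
  hm_delta : forall (X : finType) (S T I : {set X}),
    {linear hm_sp⟦I⟧ -> hm_sp⟦S⟧ ⊗ hm_sp⟦T⟧};

  hm_unitK : forall E : finType, #|E| = 0%N -> cancel (hm_unit E) (hm_counit E);
  hm_counitK : forall E : finType, #|E| = 0%N -> cancel (hm_counit E) (hm_unit E);
  hm_unit_natural : forall (E F : finType) (f : E -> F) (hf : bijective f),
    #|E| = 0%N -> forall a, sp_map hm_sp hf (hm_unit E a) = hm_unit F a;

  hm_mu_natural : forall (X Y : finType) (S T I : {set X}) (S' T' I' : {set Y})
    (f : finset_type S -> finset_type S') (g : finset_type T -> finset_type T')
    (h : finset_type I -> finset_type I')
    (hf : bijective f) (hg : bijective g) (hh : bijective h),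
    decomp S T I -> decomp S' T' I' -> restricts f h -> restricts g h ->
    forall z, sp_map hm_sp hh (hm_mu S T I z) =
      hm_mu S' T' I' (tmap (sp_map hm_sp hf) (sp_map hm_sp hg) z);
  hm_delta_natural : forall (X Y : finType) (S T I : {set X}) (S' T' I' : {set Y})
    (f : finset_type S -> finset_type S') (g : finset_type T -> finset_type T')
    (h : finset_type I -> finset_type I')
    (hf : bijective f) (hg : bijective g) (hh : bijective h),
    decomp S T I -> decomp S' T' I' -> restricts f h -> restricts g h ->
    forall x, hm_delta S' T' I' (sp_map hm_sp hh x) =
      tmap (sp_map hm_sp hf) (sp_map hm_sp hg) (hm_delta S T I x);

  hm_mu1 : forall (X : finType) (I : {set X}) (x : hm_sp⟦I⟧),
    hm_mu I set0 I (tpure x (hm_unit _ 1)) = x;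
  hm_1mu : forall (X : finType) (I : {set X}) (x : hm_sp⟦I⟧),
    hm_mu set0 I I (tpure (hm_unit _ 1) x) = x;
  hm_delta1 : forall (X : finType) (I : {set X}) (x : hm_sp⟦I⟧),
    hm_delta I set0 I x = tpure x (hm_unit _ 1);
  hm_1delta : forall (X : finType) (I : {set X}) (x : hm_sp⟦I⟧),
    hm_delta set0 I I x = tpure (hm_unit _ 1) x;

  hm_muA : forall (X : finType) (R S T RS ST I : {set X}),
    decomp R S RS -> decomp S T ST -> decomp R ST I -> decomp RS T I ->
    forall z : (hm_sp⟦R⟧ ⊗ hm_sp⟦S⟧) ⊗ hm_sp⟦T⟧,
    hm_mu R ST I (tmap idfun (hm_mu S T ST) (tassoc _ _ _ z)) =
    hm_mu RS T I (tmap (hm_mu R S RS) idfun z);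
  hm_deltaA : forall (X : finType) (R S T RS ST I : {set X}),
    decomp R S RS -> decomp S T ST -> decomp R ST I -> decomp RS T I ->
    forall x : hm_sp⟦I⟧,
    tmap idfun (hm_delta S T ST) (hm_delta R ST I x) =
    tassoc _ _ _ (tmap (hm_delta R S RS) idfun (hm_delta RS T I x));

  hm_compat : forall (X : finType) (S T S' T' I : {set X}),
    decomp S T I -> decomp S' T' I ->
    let A := S :&: S' in let B := S :&: T' in
    let C := T :&: S' in let D := T :&: T' in
    forall z : hm_sp⟦S⟧ ⊗ hm_sp⟦T⟧,
    hm_delta S' T' I (hm_mu S T I z) =
    tmap (hm_mu A C S') (hm_mu B D T')
      (tmidswap _ _ _ _ (tmap (hm_delta A B S) (hm_delta C D T) z))
}.

Record character (k : fieldType) (H : hopf_monoid k) := Character {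
  ch_map :> forall X : finType, {linear H X -> k^o};
  ch_natural : forall (X Y : finType) (f : X -> Y) (hf : bijective f) (x : H X),
    ch_map Y (sp_map H hf x) = ch_map X x;
  ch_mul : forall (X : finType) (S T I : {set X}), decomp S T I ->
    forall (x : H⟦S⟧) (y : H⟦T⟧),
    ch_map _ (hm_mu H S T I (tpure x y)) = ch_map _ x * ch_map _ y;
  ch_unit : forall E : finType, #|E| = 0%N -> ch_map E (hm_unit H E 1) = 1
}.

Section Invariants.
Variables (k : fieldType) (H : hopf_monoid k).

Fixpoint tensor_seq (X : finType) (s : seq {set X}) : lmodType k :=
  match s with
  | [::] => k^o
  | A :: s' => if s' is [::] then H⟦A⟧ else H⟦A⟧ ⊗ tensor_seq s'
  end.

(* Transport along I = J; its value when I and J differ is irrelevant. *)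
Definition sp_cast (X : finType) (I J : {set X}) : {linear H⟦I⟧ -> H⟦J⟧} :=
  match I =P J with
  | ReflectT e => ecast J {linear H⟦I⟧ -> H⟦J⟧} e idfun
  | ReflectF _ => \0
  end.

Lemma sp_cast_id (X : finType) (I : {set X}) : sp_cast I I =1 id.
Proof. by rewrite /sp_cast; case: eqP => // e; rewrite eq_axiomK. Qed.

(* Only used when [is_decomposition s I] holds; for s = (S_1, ..., S_k) with  *)
(* k >= 2 these are (id ⊗ Δ_{S_2,...,S_k}) Δ_{S_1, S_2 ⊔ ... ⊔ S_k} and its   *)
(* dual.                                                                      *)
Fixpoint delta_iter (X : finType) (s : seq {set X}) (I : {set X}) :
    {linear H⟦I⟧ -> tensor_seq s} :=
  match s return {linear H⟦I⟧ -> tensor_seq s} with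
  | [::] => hm_counit H _
  | A :: s' =>
    match s' return {linear H⟦bigunion s'⟧ -> tensor_seq s'} ->
      {linear H⟦I⟧ -> tensor_seq (A :: s')} with
    | [::] => fun _ => sp_cast I A
    | B :: s'' => fun d => tmap idfun d \o hm_delta H A (bigunion (B :: s'')) I
    end (delta_iter s' (bigunion s'))
  end.

Fixpoint mu_iter (X : finType) (s : seq {set X}) (I : {set X}) :
    {linear tensor_seq s -> H⟦I⟧} :=
  match s return {linear tensor_seq s -> H⟦I⟧} with
  | [::] => hm_unit H _
  | A :: s' =>
    match s' return {linear tensor_seq s' -> H⟦bigunion s'⟧} ->
      {linear tensor_seq (A :: s') -> H⟦I⟧} with
    | [::] => fun _ => sp_cast A I
    | B :: s'' => fun m => hm_mu H A (bigunion (B :: s'')) I \o tmap idfun m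
    end (mu_iter s' (bigunion s'))
  end.

(* The sum stops at #|I| because I has no longer compositions. *)
Definition antipode (X : finType) (I : {set X}) (x : H⟦I⟧) : H⟦I⟧ :=
  if I == set0 then x else
  \sum_(1 <= n < #|I|.+1) \sum_(s : n.-tuple {set X} | is_composition s I)
    (-1) ^+ n *: mu_iter s I (delta_iter s I x).

Variable zeta : character H.

Fixpoint zeta_iter (X : finType) (s : seq {set X}) : {linear tensor_seq s -> k^o} :=
  match s return {linear tensor_seq s -> k^o} with
  | [::] => idfun
  | A :: s' =>
    match s' return {linear tensor_seq s' -> k^o} ->
      {linear tensor_seq (A :: s') -> k^o} with
    | [::] => fun _ => zeta (finset_type A)
    | B :: s'' => fun z => tscal (zeta (finset_type A)) z
    end (zeta_iter s')
  end.

Definition chi_value (X : finType) (I : {set X}) (x : H⟦I⟧) (n : nat) : k :=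
  \sum_(s : n.-tuple {set X} | is_decomposition s I)
    zeta_iter s (delta_iter s I x).

(* The polynomial with the prescribed values on nat; it is unique when k has  *)
(* characteristic 0. ([xget 0 P] is an element of P, or 0 if P is empty.)     *)
Definition chi (X : finType) (I : {set X}) (x : H⟦I⟧) : {poly k} :=
  classical_sets.xget 0
    (fun p : {poly k} => forall n : nat, p.[n%:R] = chi_value x n).

End Invariants.

(* Main.v *)
From HB Require Import structures.
Require Import Defs.
From mathcomp Require Import all_boot all_order all_algebra boolp.
From mathcomp Require classical_sets.

Set Implicit Arguments.
Unset Strict Implicit.
Unset Printing Implicit Defensive.
Import GRing.Theory.
Local Open Scope ring_scope.

(** Families of linear forms on the spaces H[I], for I ranging over the subsets
of X, form a ring under the convolution
[(f * g)_I = sum over I = S ⊔ T of (f_S ⊗ g_T) ∘ Δ_{S,T}],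
whose unit is the counit. Iterating the product gives
[χ_I(x)(n) = (ζ^n)_I(x)] ([chi_valueE]).

A multiplicative unital family f agrees with the unit on the empty set, so
[f - 1] vanishes there; its powers beyond |X| vanish, because a set with at most
|X| elements has no longer composition. Hence f is unipotent and has two faces:
- its powers [f ^+ m] are polynomial in m, by the binomial formula
  ([unipotent_exp_poly]); for f = ζ this polynomial is χ;
- its inverse is the finite geometric series in [1 - f]
  ([unipotent_mul_geometric]), and the expansion of that series over
  compositions is f composed with the antipode, since
  [f ∘ μ_{S_1,...,S_k} = f_{S_1} ⊗ ... ⊗ f_{S_k}] for multiplicative f
  ([multiplicative_antipode]).

By compatibility of product and coproduct, and because the scalars commute, a
convolution product of multiplicative families is again multiplicative
([multiplicativeM]). So the second point applies to [f = ζ^n]: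
[χ_I(s(x))(n) = ζ^n(s(x)) = (ζ^n)^{-1}(x)], and the right-hand side is the
value at -n of the polynomial interpolating the powers of ζ
([unipotent_exp_poly_neg]). Finally, in characteristic 0 an identity of polynomials that holds at all
natural numbers holds everywhere, which passes from natural n to scalar n; the
first claim is the case n = 1. *)

(** * Powers of a unipotent element *)

Lemma poly_eq_nat (k : fieldType) (char0 : [pchar k] =i pred0) (p q : {poly k}) :
  (forall n, p.[n%:R] = q.[n%:R]) -> p = q.
Proof.
move=> epq; apply/eqP; rewrite -subr_eq0; apply/negPn/negP => nz.
pose s : seq k := [seq n%:R | n <- iota 0 (size (p - q))].
have inj : injective (fun n : nat => n%:R : k).
  suff le_inj m n : (m <= n)%N -> m%:R = n%:R :> k -> m = n.
    by move=> m n /[dup] e /esym e'; case: (leqP m n) => [|/ltnW] /le_inj->.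
  move=> le_mn /eqP; rewrite eq_sym -subr_eq0 -natrB //.
  have /GRing.pcharf0P -> := char0.
  by rewrite subn_eq0 => le_nm; apply/eqP; rewrite eqn_leq le_mn.
have := @max_poly_roots _ (p - q) s nz.
rewrite map_inj_uniq // iota_uniq size_map size_iota ltnn => no_root.
apply/notF/no_root => //.
by apply/allP => _ /mapP[n _ ->]; rewrite rootE hornerD hornerN epq subrr.
Qed.

(** The polynomial [binomial(t, i)] in the indeterminate t. *)
Definition bin_poly (k : fieldType) (i : nat) : {poly k} :=
  (i`!%:R)^-1 *: \prod_(j < i) ('X - (j%:R)%:P).

Lemma bin_polyE (k : fieldType) (char0 : [pchar k] =i pred0) (i m : nat) :
  (bin_poly k i).[m%:R] = 'C(m, i)%:R.
Proof.
have ffactE : (\prod_(j < i) ('X - (j%:R)%:P)).[m%:R] = (m ^_ i)%:R :> k.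
  elim: i => [|i ih]; first by rewrite big_ord0 hornerC.
  rewrite big_ord_recr /= hornerM ih ffactnSr natrM hornerXsubC.
  have [le_im|lt_mi] := leqP i m; first by rewrite natrB.
  by rewrite ffact_small // !mul0r.
have nz : i`!%:R != 0 :> k.
  by have /GRing.pcharf0P -> := char0; rewrite -lt0n fact_gt0.
by rewrite hornerZ ffactE -bin_ffact natrM mulrCA mulVf ?mulr1.
Qed.

(** With [z = 1 + (z - 1)], the binomial formula writes [z ^+ m] as a sum of
[(z - 1) ^+ i *+ 'C(m, i)] in which nilpotency leaves only i < N, a range that
does not depend on m. The factor [g] lets the powers of [z] be shifted in
[unipotent_exp_poly_neg]. *)
Lemma unipotent_exp_poly (k : fieldType) (char0 : [pchar k] =i pred0)
  (A : pzRingType) (e : {additive A -> k}) (z g : A) (N : nat) :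
  (z - 1) ^+ N = 0 ->
  exists p : {poly k}, forall m : nat, p.[m%:R] = e (z ^+ m * g).
Proof.
move=> nil; exists (\sum_(i < N) e ((z - 1) ^+ i * g) *: bin_poly k i) => m.
(* Both sides are sums of F, over i < N and over i <= m; F vanishes at the
   indices that belong to one range only. *)
pose F i := e ((z - 1) ^+ i * g) *+ 'C(m, i).
have F0 i : (m < i)%N || (N <= i)%N -> F i = 0.
  rewrite /F; case/orP=> [lt_mi|le_Ni]; first by rewrite bin_small ?mulr0n.
  by rewrite -(subnK le_Ni) exprD nil mulr0 mul0r raddf0 mul0rn.
transitivity (\sum_(i < maxn N m.+1) F i).
  rewrite horner_sum.
  rewrite (big_ord_widen _ (fun i => (e ((z - 1) ^+ i * g) *: bin_poly k i).[m%:R])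
    (leq_maxl N m.+1)).
  rewrite [LHS]big_mkcond; apply: eq_bigr => i _ /=.
  case: ifP => [_|/negbT]; first by rewrite hornerZ bin_polyE // mulr_natr.
  by rewrite -leqNgt => le; rewrite F0 ?le ?orbT.
rewrite -{1}[z](subrK 1) exprD1n mulr_suml raddf_sum.
rewrite (big_ord_widen _ (fun i => e ((z - 1) ^+ i *+ 'C(m, i) * g))
  (leq_maxr N m.+1)).
rewrite [RHS]big_mkcond; apply: eq_bigr => i _ /=.
case: ifP => [_|/negbT]; first by rewrite mulrnAl raddfMn.
by rewrite -leqNgt => le; rewrite F0 ?le.
Qed.

Lemma unipotent_mul_geometric (A : pzRingType) (z : A) (N : nat) :
  (z - 1) ^+ N = 0 -> z * \sum_(i < N) (1 - z) ^+ i = 1.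
Proof.
move=> nil; have := subrX1 (1 - z) N.
rewrite -[X in X ^+ N - _]opprB exprNn nil mulr0 sub0r.
by rewrite addrAC subrr add0r mulNr => /oppr_inj.
Qed.

(** The polynomial q with [q(m) = e (z ^+ m * g)] satisfies
[q(m + n) = e (z ^+ m) = p(m)], so that [q(t + n) = p(t)]; take t = -n. *)
Lemma unipotent_exp_poly_neg (k : fieldType) (char0 : [pchar k] =i pred0)
  (A : pzRingType) (e : {additive A -> k}) (z g : A) (N n : nat) (p : {poly k}) :
  (z - 1) ^+ N = 0 -> z ^+ n * g = 1 ->
  (forall m : nat, p.[m%:R] = e (z ^+ m)) -> p.[- n%:R] = e g.
Proof.
move=> nil gz pE.
have [q qE] := unipotent_exp_poly char0 e g nil.
have -> : p = q \Po ('X + n%:R%:P).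
  apply: poly_eq_nat => // m.
  rewrite horner_comp hornerD hornerX hornerC -natrD qE exprD -mulrA gz mulr1.
  exact: pE.
by rewrite horner_comp hornerD hornerX hornerC addNr -[0]/(0%:R) qE mul1r.
Qed.

(** * Linear forms on tensor products *)

Lemma linear_map_ext (k : fieldType) (U V : lmodType k) (f g : {linear U -> V}) :
  f =1 g -> f = g.
Proof.
case: f g => [f [[fa] [fs]]] [g [[ga] [gs]]] /= /funext efg.
by case: _ / efg in ga gs *; rewrite (Prop_irrelevance fa ga) (Prop_irrelevance fs gs).
Qed.

Section TensorInduction.
Variables (k : fieldType) (U V : lmodType k).

Lemma tens_ind (P : U ⊗ V -> Prop) :
  P 0 -> (forall x y, P x -> P y -> P (x + y)) ->
  (forall u v, P (tpure u v)) -> forall z, P z.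
Proof.
by move=> P0 PD Ppure z; rewrite [z]tensor_sum; apply: big_ind.
Qed.

End TensorInduction.

Section TensorScalar.
Variable k : fieldType.
Implicit Types U V W : lmodType k.

Lemma tscalDl U V (f f' : {linear U -> k^o}) (g : {linear V -> k^o}) z :
  tscal (f \+ f') g z = tscal f g z + tscal f' g z.
Proof.
elim/tens_ind: z => [|x y|u v]; first by rewrite !linear0 addr0.
  by rewrite !linearD => -> ->; rewrite addrACA.
by rewrite !tscalE mulrDl.
Qed.

Lemma tscalDr U V (f : {linear U -> k^o}) (g g' : {linear V -> k^o}) z :
  tscal f (g \+ g') z = tscal f g z + tscal f g' z.
Proof.
elim/tens_ind: z => [|x y|u v]; first by rewrite !linear0 addr0.
  by rewrite !linearD => -> ->; rewrite addrACA.
by rewrite !tscalE mulrDr.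
Qed.

Lemma tscal0l U V (f : {linear U -> k^o}) (g : {linear V -> k^o}) z :
  f =1 \0 -> tscal f g z = 0.
Proof.
move=> f0; elim/tens_ind: z => [|x y|u v]; first exact: linear0.
  by rewrite linearD => -> ->; rewrite addr0.
by rewrite tscalE f0 mul0r.
Qed.

Lemma tscal0r U V (f : {linear U -> k^o}) (g : {linear V -> k^o}) z :
  g =1 \0 -> tscal f g z = 0.
Proof.
move=> g0; elim/tens_ind: z => [|x y|u v]; first exact: linear0.
  by rewrite linearD => -> ->; rewrite addr0.
by rewrite tscalE g0 mulr0.
Qed.

Lemma tscal_suml U V (J : Type) (r : seq J) (P : pred J)
  (f : {linear U -> k^o}) (F : J -> {linear U -> k^o}) (g : {linear V -> k^o}) :
  (forall u, f u = \sum_(j <- r | P j) F j u) ->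
  forall z, tscal f g z = \sum_(j <- r | P j) tscal (F j) g z.
Proof.
move=> fE; elim/tens_ind=> [|x y ihx ihy|u v].
- by rewrite linear0 big1 // => j _; rewrite linear0.
- rewrite linearD [X in X + _]ihx [X in _ + X]ihy -big_split /=.
  by apply: eq_bigr => j _; rewrite linearD.
- by rewrite tscalE fE mulr_suml; apply: eq_bigr => j _; rewrite tscalE.
Qed.

Lemma tscal_sumr U V (J : Type) (r : seq J) (P : pred J)
  (f : {linear U -> k^o}) (g : {linear V -> k^o}) (G : J -> {linear V -> k^o}) :
  (forall v, g v = \sum_(j <- r | P j) G j v) ->
  forall z, tscal f g z = \sum_(j <- r | P j) tscal f (G j) z.
Proof.
move=> gE; elim/tens_ind=> [|x y ihx ihy|u v].
- by rewrite linear0 big1 // => j _; rewrite linear0.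
- rewrite linearD [X in X + _]ihx [X in _ + X]ihy -big_split /=.
  by apply: eq_bigr => j _; rewrite linearD.
- by rewrite tscalE gE mulr_sumr; apply: eq_bigr => j _; rewrite tscalE.
Qed.

Lemma tscal_tmap U V U' V' (f : {linear U' -> k^o}) (g : {linear V' -> k^o})
  (a : {linear U -> U'}) (b : {linear V -> V'}) z :
  tscal f g (tmap a b z) = tscal (f \o a) (g \o b) z.
Proof.
elim/tens_ind: z => [|x y|u v]; first by rewrite !linear0.
  by rewrite !linearD => -> ->.
by rewrite tmapE !tscalE.
Qed.

Lemma eq_tscal U V (f f' : {linear U -> k^o}) (g g' : {linear V -> k^o}) :
  f =1 f' -> g =1 g' -> tscal f g =1 tscal f' g'.
Proof.
move=> ef eg z; elim/tens_ind: z => [|x y|u v]; first by rewrite !linear0.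
  by rewrite !linearD => -> ->.
by rewrite !tscalE ef eg.
Qed.

Lemma tscal_assoc U V W (f : {linear U -> k^o}) (g : {linear V -> k^o})
  (h : {linear W -> k^o}) z :
  tscal f (tscal g h) (tassoc _ _ _ z) = tscal (tscal f g) h z.
Proof.
elim/tens_ind: z => [|x y|p w]; first by rewrite !linear0.
  by rewrite !linearD => -> ->.
elim/tens_ind: p => [|x y|u v]; first by rewrite linear0l !linear0.
  by rewrite linearDl !linearD => -> ->.
by rewrite tassocE !tscalE mulrA.
Qed.

(** The two middle factors are exchanged, which relies on the commutativity of
the scalars. The convolution of multiplicative families is multiplicative for
this reason. *)
Lemma tscal_midswap U V U' V' (f : {linear U -> k^o}) (g : {linear V -> k^o})
  (f' : {linear U' -> k^o}) (g' : {linear V' -> k^o}) p q :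
  tscal (tscal f f') (tscal g g') (tmidswap _ _ _ _ (tpure p q)) =
  tscal f g p * tscal f' g' q.
Proof.
elim/tens_ind: p => [|x y|u v]; first by rewrite linear0l !linear0 mul0r.
  by rewrite linearDl !linearD mulrDl => -> ->.
elim/tens_ind: q => [|x y|u' v']; first by rewrite linear0r !linear0 mulr0.
  by rewrite linearDr !linearD mulrDr => -> ->.
by rewrite tmidswapE !tscalE mulrACA.
Qed.

End TensorScalar.

(** * The convolution ring *)

Section Convolution.
Variables (k : fieldType) (H : hopf_monoid k) (X : finType).
Implicit Types I R S T U W : {set X}.

(** The index set is restricted to the subsets of a fixed X, which contains all
blocks of decompositions of its subsets. Since X bounds their size, the powers of
a family that vanishes on the empty set are zero from one exponent on. *)
Definition conv : Type := forall I, {linear H⟦I⟧ -> k^o}.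

HB.instance Definition _ := gen_eqMixin conv.
HB.instance Definition _ := gen_choiceMixin conv.

Lemma conv_ext (f g : conv) : (forall I, f I =1 g I) -> f = g.
Proof.
move=> efg; apply: functional_extensionality_dep => I.
exact/linear_map_ext/efg.
Qed.

Definition conv_add (f g : conv) : conv := fun I => f I \+ g I.
Definition conv_zero : conv := fun I => \0.
Definition conv_opp (f : conv) : conv := fun I => \- f I.

Lemma conv_addA : associative conv_add.
Proof. by move=> f g h; apply: conv_ext => I x; rewrite /= addrA. Qed.
Lemma conv_addC : commutative conv_add.
Proof. by move=> f g; apply: conv_ext => I x; rewrite /= addrC. Qed.
Lemma conv_add0 : left_id conv_zero conv_add.
Proof. by move=> f; apply: conv_ext => I x; rewrite /= add0r. Qed.
Lemma conv_addN : left_inverse conv_zero conv_opp conv_add.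
Proof. by move=> f; apply: conv_ext => I x; rewrite /= addNr. Qed.

HB.instance Definition _ :=
  GRing.isZmodule.Build conv conv_addA conv_addC conv_add0 conv_addN.

Lemma convD (f g : conv) I x : (f + g) I x = f I x + g I x.
Proof. by []. Qed.

Lemma convB (f g : conv) I x : (f - g) I x = f I x - g I x.
Proof. by []. Qed.

Definition conv_mul_fun (f g : conv) I (x : H⟦I⟧) : k^o :=
  \sum_(p : {set X} * {set X} | decomp p.1 p.2 I)
    tscal (f p.1) (g p.2) (hm_delta H p.1 p.2 I x).

Lemma conv_mul_is_linear f g I : linear (@conv_mul_fun f g I).
Proof.
move=> a x y; rewrite /conv_mul_fun scaler_sumr -big_split /=.
by apply: eq_bigr => p _; rewrite !linearP.
Qed.
HB.instance Definition _ f g I := GRing.isLinear.Build k H⟦I⟧ k^o *:%R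
  (@conv_mul_fun f g I) (@conv_mul_is_linear f g I).

Definition conv_mul (f g : conv) : conv := fun I => @conv_mul_fun f g I.

Definition conv_one : conv := fun I =>
  if I == set0 then hm_counit H (finset_type I) else \0.

Lemma conv_mulE f g I x : conv_mul f g I x =
  \sum_(p : {set X} * {set X} | decomp p.1 p.2 I)
    tscal (f p.1) (g p.2) (hm_delta H p.1 p.2 I x).
Proof. by []. Qed.

(** Counting memberships turns identities between decompositions into
boolean case analyses, one point at a time. *)
Lemma decompP S T I :
  reflect (forall a, ((a \in S) + (a \in T) = (a \in I))%N) (decomp S T I).
Proof.
rewrite /decomp -setI_eq0; apply: (iffP andP) => [[/eqP/setP d /eqP/setP u] a|d].
  by have := d a; have := u a; rewrite !inE; do !case: (a \in _).
by split; apply/eqP/setP => a; have := d a; rewrite !inE; do !case: (a \in _).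
Qed.

Lemma decompI0 S I : decomp S set0 I = (S == I).
Proof. by rewrite /decomp disjoint_sym disjoints_subset sub0set setU0. Qed.

Lemma decomp0I T I : decomp set0 T I = (T == I).
Proof. by rewrite /decomp disjoints_subset sub0set set0U. Qed.

Lemma card_empty_set : #|finset_type (set0 : {set X})| = 0%N.
Proof. by rewrite card_sig; apply: eq_card0 => x; rewrite inE. Qed.

(** Both sides say that I is the disjoint union of R, S and T. *)
Lemma decompA R S T I :
  decomp (R :|: S) T I && decomp R S (R :|: S) =
  decomp R (S :|: T) I && decomp S T (S :|: T).
Proof.
rewrite /decomp !eqxx !andbT setUA -!setI_eq0 setIUl setIUr !setU_eq0.
by case: (R :&: S == _); case: (R :&: T == _); case: (S :&: T == _); case: eqP.
Qed.

Lemma conv_mul1 : right_id conv_one conv_mul.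
Proof.
move=> f; apply: conv_ext => I x; rewrite conv_mulE.
rewrite (bigD1 (I, set0)) /= ?decompI0 // big1 ?addr0.
  rewrite hm_delta1 tscalE /conv_one eqxx hm_unitK ?mulr1 //.
  exact: card_empty_set.
move=> [S T] /= /andP[dST]; rewrite /conv_one.
case: (T =P set0) => [T0|_ _]; last by rewrite tscal0r.
by move: dST; rewrite T0 decompI0 => /eqP ->; rewrite eqxx.
Qed.

Lemma conv_1mul : left_id conv_one conv_mul.
Proof.
move=> f; apply: conv_ext => I x; rewrite conv_mulE.
rewrite (bigD1 (set0, I)) /= ?decomp0I // big1 ?addr0.
  rewrite hm_1delta tscalE /conv_one eqxx hm_unitK ?mul1r //.
  exact: card_empty_set.
move=> [S T] /= /andP[dST]; rewrite /conv_one.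
case: (S =P set0) => [S0|_ _]; last by rewrite tscal0l.
by move: dST; rewrite S0 decomp0I => /eqP ->; rewrite eqxx.
Qed.

Lemma conv_mulA : associative conv_mul.
Proof.
move=> f g h; apply: conv_ext => I x; rewrite !conv_mulE.
transitivity (\sum_(p : {set X} * {set X} | decomp p.1 p.2 I)
  \sum_(q : {set X} * {set X} | decomp q.1 q.2 p.2)
    tscal (f p.1) (tscal (g q.1) (h q.2))
      (tmap idfun (hm_delta H q.1 q.2 p.2) (hm_delta H p.1 p.2 I x))).
  apply: eq_bigr => -[R W] /= _; under eq_bigr do rewrite tscal_tmap.
  exact: tscal_sumr.
transitivity (\sum_(p : {set X} * {set X} | decomp p.1 p.2 I)
  \sum_(q : {set X} * {set X} | decomp q.1 q.2 p.1)
    tscal (tscal (f q.1) (g q.2)) (h p.2)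
      (tmap (hm_delta H q.1 q.2 p.1) idfun (hm_delta H p.1 p.2 I x))); last first.
  apply: eq_bigr => -[U T] /= _; under eq_bigr do rewrite tscal_tmap.
  exact/esym/tscal_suml.
(* Both sums range over the decompositions of I into R, S, T: on the left with
   W = S ⊔ T as intermediate block, on the right with U = R ⊔ S. *)
rewrite !pair_big_dep /=.
pose ra (p : ({set X} * {set X}) * ({set X} * {set X})) :=
  ((p.1.1 :|: p.2.1, p.2.2), (p.1.1, p.2.1)).
pose la (p : ({set X} * {set X}) * ({set X} * {set X})) :=
  ((p.2.1, p.2.2 :|: p.1.2), (p.2.2, p.1.2)).
rewrite [RHS](reindex_onto ra la) /ra /la /=; last first.
  by move=> [[U T] [R S]] /= /andP[_ /andP[_ /eqP ->]].
apply: eq_big => [[[R W] [S T]]|[[R W] [S T]] /= /andP[dRW dST]].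
  rewrite /= !xpair_eqE !eqxx !andbT /= decompA.
  apply/idP/idP => [/andP[dRW dST]|/andP[d /eqP <-] //].
  by have /andP[_ /eqP ->] := dST; rewrite dRW dST eqxx.
have := decompA R S T I; have /andP[_ /eqP ->] := dST.
rewrite dRW dST => /andP[dUT dRS].
by rewrite (hm_deltaA dRS dST dRW dUT) tscal_assoc.
Qed.

Lemma conv_mulDl : left_distributive conv_mul +%R.
Proof.
move=> f g h; apply: conv_ext => I x; rewrite convD !conv_mulE -big_split /=.
by apply: eq_bigr => p _; rewrite -tscalDl.
Qed.

Lemma conv_mulDr : right_distributive conv_mul +%R.
Proof.
move=> f g h; apply: conv_ext => I x; rewrite convD !conv_mulE -big_split /=.
by apply: eq_bigr => p _; rewrite -tscalDr.
Qed.

HB.instance Definition _ := GRing.Zmodule_isPzRing.Build conv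
  conv_mulA conv_1mul conv_mul1 conv_mulDl conv_mulDr.

Definition conv_eval I (x : H⟦I⟧) (f : conv) : k := f I x.

Lemma conv_eval_is_additive I (x : H⟦I⟧) : zmod_morphism (conv_eval x).
Proof. by []. Qed.
HB.instance Definition _ I (x : H⟦I⟧) :=
  GRing.isZmodMorphism.Build conv k (conv_eval x) (@conv_eval_is_additive I x).

Lemma conv1E I (x : H⟦I⟧) :
  (1 : conv) I x = if I == set0 then hm_counit H (finset_type I) x else 0.
Proof. by rewrite [LHS]/(conv_one _ _) /conv_one; case: ifP. Qed.

Lemma convME (f g : conv) I x : (f * g) I x =
  \sum_(p : {set X} * {set X} | decomp p.1 p.2 I)
    tscal (f p.1) (g p.2) (hm_delta H p.1 p.2 I x).
Proof. exact: conv_mulE. Qed.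

(** The form f_{S_1} ⊗ ... ⊗ f_{S_k}; the case distinction on the tail follows
the one in [tensor_seq]. *)
Fixpoint fam_iter (f : conv) (s : seq {set X}) : {linear tensor_seq H s -> k^o} :=
  match s return {linear tensor_seq H s -> k^o} with
  | [::] => idfun
  | A :: s' =>
    match s' return {linear tensor_seq H s' -> k^o} ->
      {linear tensor_seq H (A :: s') -> k^o} with
    | [::] => fun _ => f A
    | B :: s'' => fun z => tscal (f A) z
    end (fam_iter f s')
  end.

Lemma bigunion_nil : bigunion [::] = set0 :> {set X}.
Proof. exact: big_nil. Qed.

Lemma bigunion_cons S (s : seq {set X}) : bigunion (S :: s) = S :|: bigunion s.
Proof. exact: big_cons. Qed.

Lemma is_decomposition_nil I : is_decomposition [::] I = (I == set0).
Proof. by rewrite /is_decomposition bigunion_nil eq_sym. Qed.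

Lemma is_decomposition_cons S (s : seq {set X}) I :
  is_decomposition (S :: s) I =
  decomp S (bigunion s) I && is_decomposition s (bigunion s).
Proof.
rewrite /is_decomposition /decomp bigunion_cons eqxx andbT pairwise_cons.
rewrite andbAC; congr (_ && _ && _).
rewrite disjoint_sym /bigunion; elim: s => [|T s ih].
  by rewrite big_nil disjoints_subset sub0set.
by rewrite big_cons /= ih -!setI_eq0 setIUl setU_eq0 setIC.
Qed.

(** Unitality removes the special treatment of one-term sequences: the last
step may be seen as Δ_{S,∅} followed by the counit. *)
Lemma fam_iter_delta_cons (f : conv) S (s : seq {set X}) I x :
  decomp S (bigunion s) I ->
  fam_iter f (S :: s) (delta_iter H (S :: s) I x) =
  tscal (f S) (fam_iter f s \o delta_iter H s (bigunion s))
    (hm_delta H S (bigunion s) I x).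
Proof.
case: s => [|T s] dI.
  rewrite [RHS](_ : _ = tscal (f S) (hm_counit H (finset_type (bigunion [::])))
    (hm_delta H S (bigunion [::]) I x)) //.
  move: dI; rewrite bigunion_nil decompI0 => /eqP eSI.
  rewrite -{I}eSI in x *.
  by rewrite /= sp_cast_id hm_delta1 tscalE hm_unitK ?mulr1 ?card_empty_set.
rewrite [LHS]/= tscal_tmap; exact: eq_tscal.
Qed.

(** A decomposition of I into n + 1 parts is a first part S together with a
decomposition of the rest into n parts. *)
Lemma conv_expE (f : conv) (n : nat) I (x : H⟦I⟧) :
  (f ^+ n) I x =
  \sum_(s : n.-tuple {set X} | is_decomposition s I)
    fam_iter f s (delta_iter H s I x).
Proof.
elim: n I x => [|n ih] I x.
  rewrite expr0 conv1E (eq_bigl (fun s => (I == set0) && (s == [tuple]))).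
    case: (I == set0); last by rewrite big_pred0.
    by rewrite (big_pred1 [tuple]).
  by move=> s; rewrite tuple0 is_decomposition_nil eqxx andbT.
rewrite exprS convME.
under eq_bigr => p _ do
  rewrite (tscal_sumr (f p.1) (g := (f ^+ n) p.2) (G := fun s : n.-tuple {set X} =>
    fam_iter f s \o delta_iter H s p.2) (ih p.2)).
rewrite pair_big_dep /=.
rewrite (reindex (fun q : {set X} * n.-tuple {set X} => [tuple of q.1 :: q.2])); last first.
  exists (fun s : n.+1.-tuple {set X} => (thead s, behead_tuple s)) => [[S s]|s] _ /=.
    by rewrite theadE; congr pair; apply: val_inj.
  by rewrite [RHS]tuple_eta.
rewrite (reindex_onto (fun q : {set X} * n.-tuple {set X} => ((q.1, bigunion q.2), q.2))
  (fun p => (p.1.1, p.2))) /=; last first.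
  by move=> [[S T] s] /= /andP[_ /andP[_ /eqP ->]].
apply: eq_big => [[S s]|[S s] /= /andP[/andP[dI _] _]].
  by rewrite eqxx andbT is_decomposition_cons.
by rewrite fam_iter_delta_cons.
Qed.

(** A decomposition of I into more than #|I| parts has an empty part. The
induction removes the first part, which may be assumed nonempty. *)
Lemma conv_exp_small (f : conv) (n : nat) I : f set0 =1 \0 -> (#|I| < n)%N ->
  (f ^+ n) I =1 \0.
Proof.
move=> f0; elim: n I => // n ih I; rewrite ltnS => le_In x.
rewrite exprS convME big1 // => -[S T] /= /andP[dST /eqP eI].
have [S0|nzS] := eqVneq S set0; first by rewrite tscal0l // S0.
apply/tscal0r/ih/(leq_trans _ le_In).
rewrite -eI cardsU disjoint_setI0 // cards0 subn0.
by rewrite -[X in (X < _)%N]add0n ltn_add2r card_gt0.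
Qed.

Lemma fam_iter_empty (f : conv) (s : seq {set X}) z :
  f set0 =1 \0 -> set0 \in s -> fam_iter f s z = 0.
Proof.
move=> f0; elim: s z => // S [|T s] ih z.
  by rewrite inE => /eqP eS; move: z => /=; rewrite -eS.
rewrite in_cons; have [eS _|_ /= s0] := eqVneq.
  by apply: tscal0l; rewrite -eS.
by apply: tscal0r => y; apply: ih.
Qed.

Lemma fam_iter_opp (f g : conv) (s : seq {set X}) z :
  (forall S, S \in s -> forall x, g S x = - f S x) ->
  fam_iter g s z = (-1) ^+ size s * fam_iter f s z.
Proof.
elim: s z => [|S s ih] z gE; first by rewrite mul1r.
case: s ih z gE => [|T s] ih z gE.
  by rewrite expr1 mulN1r; apply: gE; rewrite inE.
elim/tens_ind: z => [|x y ihx ihy|u v]; first by rewrite !linear0 mulr0.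
  by rewrite !linearD mulrDr; congr (_ + _).
rewrite [LHS]tscalE [fam_iter f _ _]tscalE gE ?inE ?eqxx // ih.
  by rewrite [size (S :: _)]/= exprS mulN1r !mulNr mulrCA.
by move=> U Us; apply: gE; rewrite in_cons Us orbT.
Qed.

(** * Multiplicative families *)

Record multiplicative (f : conv) : Prop := Multiplicative {
  multiplicative_unit : f set0 (hm_unit H _ 1) = 1;
  multiplicative_mu : forall S T I, decomp S T I ->
    forall x y, f I (hm_mu H S T I (tpure x y)) = f S x * f T y
}.

(** Connectedness: H[∅] is spanned by the unit. *)
Lemma multiplicative_set0 (f : conv) : multiplicative f -> f set0 =1 hm_counit H _.
Proof.
move=> [f1 _] x; rewrite -{1}[x](hm_counitK card_empty_set).
by rewrite -[hm_counit _ _ x]mulr1 linearZ /= linearZ /= f1.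
Qed.

Lemma multiplicative1 : multiplicative 1.
Proof.
split=> [|S T I dI]; first by rewrite conv1E eqxx hm_unitK ?card_empty_set.
have /andP[_ /eqP eI] := dI.
have [S0|nzS] := eqVneq S set0; last first.
  by move=> x y; rewrite !conv1E -eI setU_eq0 (negPf nzS) mul0r.
have [T0|nzT] := eqVneq T set0; last first.
  by move=> x y; rewrite !conv1E -eI setU_eq0 (negPf nzT) andbF mulr0.
have {eI} I0 : I = set0 by rewrite -eI S0 T0 setU0.
subst S T; subst I => x y; rewrite !conv1E eqxx.
rewrite -{1}[y](hm_counitK card_empty_set); set c : k := hm_counit _ _ y.
rewrite -{1}[c]mulr1 [hm_unit _ _ _]linearZ /= linearZr_LR linearZ /= hm_mu1.
by rewrite linearZ /= mulrC.
Qed.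

Lemma multiplicative_tens (f : conv) S T I : multiplicative f -> decomp S T I ->
  f I \o hm_mu H S T I =1 tscal (f S) (f T).
Proof.
move=> mf dI; apply: tensor_linear_ext => x y.
by rewrite tscalE -(multiplicative_mu mf dI).
Qed.

(** For [I = S ⊔ T], compatibility expands Δ_{S',T'} ∘ μ_{S,T} through the four
intersections of S, T with S', T', and (S', T') is determined by the two
decompositions that it induces on S and on T. *)
Lemma multiplicativeM (f g : conv) :
  multiplicative f -> multiplicative g -> multiplicative (f * g).
Proof.
move=> mf mg; split=> [|S T I dI x y].
  rewrite convME (big_pred1 (set0, set0)) => [|[S T]] /=; last first.
    rewrite xpair_eqE /decomp setU_eq0.
    by case: (S =P set0) => [->|]; rewrite ?disjoints_subset ?sub0set ?andbF.
  by rewrite hm_delta1 tscalE !multiplicative_unit ?mulr1.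
rewrite convME.
under eq_bigr => p dI' do rewrite (hm_compat dI dI') tscal_tmap tmapE.
rewrite !convME big_distrlr /= pair_big_dep /=.
rewrite (reindex_onto
  (fun q => ((S :&: q.1, S :&: q.2), (T :&: q.1, T :&: q.2)))
  (fun p => (p.1.1 :|: p.2.1, p.1.2 :|: p.2.2))) /=; last first.
  move=> [[A B] [C D]] /= /andP[/decompP dS /decompP dT].
  by congr ((_, _), (_, _)); apply/setP => a;
    have := dS a; have := dT a; have := decompP _ _ _ dI a; rewrite !inE;
    do !case: (a \in _).
(* The right-hand side is the range of summation that the reindexing produces;
   its last two conditions say that the two index maps compose to the identity. *)
have compat S' T' : decomp S' T' I =
  [&& decomp (S :&: S') (S :&: T') S, decomp (T :&: S') (T :&: T') T,
      (S :&: S') :|: (T :&: S') == S' & (S :&: T') :|: (T :&: T') == T'].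
  have := decompP _ _ _ dI => {}dI.
  apply/decompP/and4P => [dI'|[/decompP dS /decompP dT /eqP/setP eS /eqP/setP eT] a].
    split; try apply/decompP => a; try (apply/eqP/setP => a);
    by have := dI a; have := dI' a; rewrite !inE; do !case: (a \in _).
  have := dI a; have := dS a; have := dT a; have := eS a; have := eT a.
  by rewrite !inE; do !case: (a \in _).
apply: eq_big => [[S' T']|[S' T'] /= dI'].
  by rewrite /= compat xpair_eqE -!andbA.
have [dS dT] : decomp (S :&: S') (T :&: S') S' /\ decomp (S :&: T') (T :&: T') T'.
  have := decompP _ _ _ dI => {}dI; have := decompP _ _ _ dI' => {}dI'.
  by split; apply/decompP => a; have := dI a; have := dI' a; rewrite !inE;
    do !case: (a \in _).
by rewrite -tscal_midswap; apply: eq_tscal => z; apply: multiplicative_tens.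
Qed.

Lemma multiplicativeX (f : conv) n : multiplicative f -> multiplicative (f ^+ n).
Proof.
move=> mf; elim: n => [|n ih]; first exact: multiplicative1.
by rewrite exprS; apply: multiplicativeM.
Qed.

Lemma multiplicative_mu_iter (f : conv) (s : seq {set X}) I z :
  multiplicative f -> is_decomposition s I ->
  f I (mu_iter H s I z) = fam_iter f s z.
Proof.
move=> mf; elim: s I z => [|S s ih] I z.
  rewrite is_decomposition_nil => /eqP ->.
  by rewrite multiplicative_set0 //= hm_unitK ?card_empty_set.
rewrite is_decomposition_cons; case: s ih z => [|T s] ih z /andP[dI ds].
  move: dI; rewrite bigunion_nil decompI0 => /eqP eSI.
  by move: z; rewrite -eSI /= => z; rewrite sp_cast_id.
elim/tens_ind: z => [|x y ihx ihy|u v]; first by rewrite !linear0.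
  by rewrite !linearD ihx ihy.
rewrite [RHS]tscalE -(ih _ _ ds) -(multiplicative_mu mf dI).
by congr (f I _); rewrite -[LHS]/(hm_mu _ _ _ _ (tmap _ _ _)) tmapE.
Qed.

(** The term i of the geometric series is a sum over all decompositions into i
parts; as [1 - f] is zero on the empty set and -f on nonempty sets, only the
compositions remain, each with the sign [(-1) ^+ i]. *)
Lemma multiplicative_antipode (f : conv) I (x : H⟦I⟧) : multiplicative f ->
  f I (antipode x) = (\sum_(i < #|X|.+1) (1 - f) ^+ i) I x.
Proof.
move=> mf; have f0 : (1 - f) set0 =1 \0.
  by move=> y; rewrite convB conv1E eqxx (multiplicative_set0 mf); apply: subrr.
rewrite -[RHS]/(conv_eval x _) raddf_sum.
rewrite -(big_mkord xpredT (fun i => ((1 - f) ^+ i) I x)).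
have le_IX : (#|I|.+1 <= #|X|.+1)%N by rewrite ltnS max_card.
(* The bound #|X| does not depend on I; the terms beyond #|I| are zero. *)
rewrite (big_cat_nat (leq0n _) le_IX) /= [X in _ + X]big_nat_cond.
rewrite [X in _ + X]big1 ?addr0; last first.
  by move=> i /andP[/andP[lt_Ii _] _]; rewrite conv_exp_small.
rewrite big_ltn // expr0 conv1E /antipode.
have [I0|nzI] := eqVneq I set0.
  rewrite big_geq; last by rewrite I0 cards0.
  by rewrite addr0; move: x; rewrite I0 => x; apply: multiplicative_set0.
rewrite add0r linear_sum; apply: eq_bigr => n _.
rewrite linear_sum conv_expE /is_composition [LHS]big_mkcondr.
apply: eq_bigr => s ds; case: ifPn => [/allP nes|]; last first.
  rewrite -has_predC => /hasP[S Ss /negbNE/eqP S0].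
  by rewrite fam_iter_empty // -S0.
rewrite linearZ /= multiplicative_mu_iter // [RHS](@fam_iter_opp f) ?size_tuple //.
by move=> S /nes /negPf nzS y; rewrite convB conv1E nzS; apply: sub0r.
Qed.

(** * The polynomial invariant *)

Variable zeta : character H.

Definition conv_of_character : conv := fun I => zeta (finset_type I).

Lemma multiplicative_character : multiplicative conv_of_character.
Proof.
split=> [|S T I dI x y]; first by rewrite /conv_of_character ch_unit ?card_empty_set.
exact: ch_mul.
Qed.

Lemma chi_valueE I (x : H⟦I⟧) n :
  chi_value zeta x n = (conv_of_character ^+ n) I x.
Proof.
rewrite conv_expE; apply: eq_bigr => s _.
elim: (tval s) (delta_iter _ _ _ _) => // S [|T t] ih z //.
exact: eq_tscal.
Qed.

Lemma multiplicative_unipotent (f : conv) :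
  multiplicative f -> (f - 1) ^+ #|X|.+1 = 0.
Proof.
move=> mf; apply: conv_ext => I x; rewrite conv_exp_small ?ltnS ?max_card // => y.
by rewrite convB conv1E eqxx (multiplicative_set0 mf); apply: subrr.
Qed.

End Convolution.

(** [chi] is defined as some polynomial with the prescribed values; one exists
because the values are those of the powers of a unipotent element. *)
Lemma horner_chi (k : fieldType) (char0 : [pchar k] =i pred0)
  (H : hopf_monoid k) (zeta : character H)
  (X : finType) (I : {set X}) (x : H⟦I⟧) (n : nat) :
  (chi zeta x).[n%:R] = chi_value zeta x n.
Proof.
have [p pE] := unipotent_exp_poly char0 (conv_eval x) 1
  (multiplicative_unipotent (multiplicative_character X zeta)).
apply: (@classical_sets.xgetPex _ 0
  (fun q : {poly k} => forall m : nat, q.[m%:R] = chi_value zeta x m)).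
by exists p => m; rewrite pE mulr1 chi_valueE.
Qed.

Theorem proposition16p5 (k : fieldType) (char0 : [pchar k] =i pred0)
  (H : hopf_monoid k) (zeta : character H)
  (X : finType) (I : {set X}) (x : H⟦I⟧) :
  (chi zeta x).[-1] = zeta (finset_type I) (antipode x) /\
  forall n : k, (chi zeta x).[- n] = (chi zeta (antipode x)).[n].
Proof.
have mz := multiplicative_character X zeta.
have at_nat (n : nat) :
    (chi zeta x).[- n%:R] = chi_value zeta (antipode x) n.
  have mzn := multiplicativeX n mz.
  rewrite chi_valueE multiplicative_antipode // -[RHS]/(conv_eval x _).
  apply: (unipotent_exp_poly_neg char0 (multiplicative_unipotent mz)).
    exact/unipotent_mul_geometric/multiplicative_unipotent.
  by move=> m; rewrite horner_chi // chi_valueE.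
split.
  rewrite -[1]/(1%:R) at_nat chi_valueE; exact: (erefl _).
have : chi zeta x \Po (- 'X) = chi zeta (antipode x).
  apply: poly_eq_nat => // m.
  by rewrite horner_comp hornerN hornerX at_nat horner_chi.
by move=> <- n; rewrite horner_comp hornerN hornerX.
Qed.
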